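(* Let $A,B\in\mathbb{R}^{n\times n}$ be symmetric positive definite and let $f(x)=-\dfrac{x^{\mathsf T}B^{-1}x}{x^{\mathsf T}B^{-1/2}AB^{-1/2}x}$ for $x\in\mathbb{S}^{n-1}$. Consider the iterates $x_t$ produced from $x_0\in\mathbb{S}^{n-1}$ by the recurrence $x_{t+1}=\exp_{x_t}(-\eta_t\operatorname{grad}f(x_t))$ with step sizes satisfying $0<\eta_t<\dfrac{\pi}{2\|\operatorname{grad}f(x_t)\|}$. Then the transformed vectors $u_t:=B^{-1/2}x_t$ satisfy the recurrence $$u_{t+1}=\beta_{t+1}\bigl(u_t-\eta_t^*B^{-1}r_t\bigr)$$ with a certain step size $\eta_t^*>0$, a normalization $\beta_{t+1}>0$ chosen such that $\|u_{t+1}\|_B=1$, and the residual $r_t=Au_t-\lambda(u_t)u_t$.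
   Context: $\|\cdot\|$ is the Euclidean norm, $\|v\|_B:=\sqrt{v^{\mathsf T}Bv}$, and $\lambda(u):=u^{\mathsf T}Au/u^{\mathsf T}u$ is the Rayleigh quotient. $A$ has eigenvalues $0<\lambda_1<\lambda_2\le\dots\le\lambda_n$. $\mathbb{S}^{n-1}$ is the unit sphere in $\mathbb{R}^n$, viewed as a Riemannian submanifold with the restricted Euclidean metric; $\operatorname{grad}f(x)=(I-xx^{\mathsf T})\nabla f(x)$ is the Riemannian gradient, and $\exp_x(v)=\cos(\|v\|)x+\sin(\|v\|)v/\|v\|$ for $v\perp x$, $v\ne0$, with $\exp_x(0)=x$. When $\operatorname{grad}f(x_t)=0$, the upper bound on $\eta_t$ is void (read as $+\infty$). *)

(* Defs.v *)
From mathcomp Require Import all_boot all_order all_algebra.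
From mathcomp Require Import complex.
From mathcomp Require Import all_classical all_reals all_analysis.

Set Implicit Arguments.
Unset Strict Implicit.
Unset Printing Implicit Defensive.

Import Order.TTheory GRing.Theory Num.Theory.
Import numFieldNormedType.Exports.

Local Open Scope classical_set_scope.
Local Open Scope ring_scope.

Section LinearAlgebra.
Context {R : realType} {n : nat}.
Implicit Types (M : 'M[R]_n) (x v : 'cV[R]_n) (lam : 'I_n -> R).

Definition qform M v : R := (v^T *m M *m v) 0 0.

Definition posdefmx M : Prop := M^T = M /\ forall v, v != 0 -> 0 < qform M v.

(* The norm `|v| that the library puts on matrices is the maximum norm. *)
Definition enorm v : R := Num.sqrt ((v^T *m v) 0 0).

Definition wnorm M v : R := Num.sqrt (qform M v).

Definition rayleigh M v : R := qform M v / (v^T *m v) 0 0.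

(* lam lists the eigenvalues with multiplicity, in nondecreasing order. *)
Definition eigenvalue_list M lam : Prop :=
  char_poly M = \prod_i ('X - (lam i)%:P) /\
  forall i j : 'I_n, (i <= j)%N -> lam i <= lam j.

(* Meaningful for positive definite M, where the positive definite square root
   exists and is unique (sqrtmxP, posdefmx_sqr_inj). *)
Definition sqrtmx M : 'M[R]_n :=
  xget 0 [set S | posdefmx S /\ S *m S = M].

Definition invsqrtmx M : 'M[R]_n := invmx (sqrtmx M).

End LinearAlgebra.

Section Sphere.
Context {R : realType} {n : nat}.
Implicit Types (f : 'cV[R]_n -> R) (x v : 'cV[R]_n).

Definition on_sphere x : Prop := enorm x = 1.

(* The vector of partial derivatives. *)
Definition egrad f x : 'cV[R]_n := \col_i 'D_(delta_mx i 0) f x.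

(* f is a smooth extension, to a neighbourhood of the sphere, of the function
   whose Riemannian gradient is taken. *)
Definition rgrad f x : 'cV[R]_n := (1%:M - x *m x^T) *m egrad f x.

Definition sphere_exp x v : 'cV[R]_n :=
  if v == 0 then x
  else cos (enorm v) *: x + (sin (enorm v) / enorm v) *: v.

End Sphere.

Definition objective (R : realType) (n : nat) (A B : 'M[R]_n)
    (x : 'cV[R]_n) : R :=
  - (qform (invmx B) x / qform (invsqrtmx B *m A *m invsqrtmx B) x).


Section SquareRoot.
Context {R : realType}.

Lemma posdefmx_eigen n (M : 'M[R]_n) a :
  posdefmx M -> eigenvalue M a -> 0 < a.
Proof.
move=> [MT Mpos] /eigenvalueP[v vM v0].
have vT0 : v^T != 0 by rewrite -(inj_eq trmx_inj) trmxK trmx0.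
have vv0 : 0 <= (v *m v^T) 0 0.
  by rewrite mxE sumr_ge0// => i _; rewrite mxE -expr2 sqr_ge0.
have := Mpos _ vT0; rewrite /qform trmxK vM -scalemxAl mxE => avv.
by rewrite ltNge; apply: contraTN avv => a0; rewrite -leNgt mulr_le0_ge0.
Qed.

Lemma posdefmx_unit n (M : 'M[R]_n) : posdefmx M -> M \in unitmx.
Proof.
move=> [_ Mpos]; rewrite -unitmx_tr -row_free_unit -kermx_eq0.
apply: contraT => /rowV0Pn[v /sub_kermxP vM v0].
have /Mpos : v^T != 0 by rewrite -(inj_eq trmx_inj) trmxK trmx0.
rewrite /qform trmxK.
have -> : v *m M *m v^T = (v *m M^T *m v^T)^T.
  by rewrite !trmx_mul !trmxK mulmxA.
by rewrite vM mul0mx trmx0 mxE ltxx.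
Qed.

Let interpolation (s : seq R) (g : R -> R) :
  exists p : {poly R}, {in s, forall a, p.[a] = g a}.
Proof.
elim: s => [|a s [p ps]]; first by exists 0.
have [as_|as_] := boolP (a \in s).
  by exists p => b; rewrite inE => /orP[/eqP ->|]; apply: ps.
pose w := \prod_(b <- s) ('X - b%:P).
have wa : w.[a] != 0 by rewrite -rootE root_prod_XsubC.
exists (p + ((g a - p.[a]) / w.[a])%:P * w) => b.
rewrite inE !hornerE => /orP[/eqP ->|bs].
  by rewrite divfK// addrC subrK.
have /rootP -> : root w b by rewrite root_prod_XsubC.
by rewrite mulr0 addr0 ps.
Qed.

Let horner_mx_sym n (M : 'M[R]_n.+1) p :
  M^T = M -> (horner_mx M p)^T = horner_mx M p.
Proof.
move=> MT; elim/poly_ind: p => [|p c IHp]; first by rewrite rmorph0 trmx0.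
rewrite rmorphD rmorphM /= horner_mx_X horner_mx_C raddfD/= tr_scalar_mx.
rewrite trmx_mul IHp MT; congr (_ + _).
exact/comm_mx_horner/comm_mx_refl.
Qed.

Let sym_horner_eq0 n (M : 'M[R]_n.+1) (p : {poly R}) : M^T = M ->
  (forall a, eigenvalue M a -> p.[a] = 0) -> horner_mx M p = 0.
Proof.
move=> MT p0; pose toC := real_complex R.
apply: (@map_mx_inj _ _ toC); rewrite map_mx0 map_horner_mx.
set N := map_mx _ M.
have Nreal : N \is a realmx.
  by apply/mxOverP => i j; rewrite mxE complex_real.
have Nherm : N \is hermsymmx.
  apply: realsym_hermsym => //; apply/is_hermitianmxP.
  by rewrite expr0 scale1r map_mx_id//; apply/matrixP => i j; rewrite !mxE -{1}MT mxE.
have := hermitian_spectral_diag_real Nherm.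
have /hermitian_normalmx/orthomx_spectralP := Nherm.
set P := spectralmx N; set d := spectral_diag N => NE dreal.
have Pu : P \in unitmx by exact: spectral_unit.
rewrite NE horner_mx_uconjC// horner_mx_diag.
suff -> : map_mx (horner (map_poly toC p)) d = 0.
  by rewrite (_ : diag_mx 0 = 0) ?mulmx0 ?mul0mx// raddf0.
apply/matrixP => i j; rewrite !mxE ord1 {i}.
have /complex_realP [a da] : d 0 j \is Num.real by exact: mxOverP.
rewrite da horner_map p0 ?rmorph0//.
suff : eigenvalue N (toC a).
  by rewrite !eigenvalue_root_char /N -map_char_poly fmorph_root.
apply/eigenvalueP; exists (row j P).
  rewrite -row_mul {1}NE !mulmxA mulmxV// mul1mx mul_diag_mx.
  by apply/rowP => k; rewrite !mxE da.
have : row_free P by rewrite row_free_unit.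
apply: contraL => /eqP rP0; rewrite -kermx_eq0; apply/rowV0Pn.
exists (delta_mx 0 j); first by apply/sub_kermxP; rewrite -rowE.
apply/eqP => /rowP /(_ j); rewrite !mxE !eqxx => /eqP.
by rewrite oner_eq0.
Qed.

Let sqrtmx_exists n (M : 'M[R]_n) : posdefmx M ->
  exists S, posdefmx S /\ S *m S = M.
Proof.
case: n M => [|n] M Mpd.
  exists 0; split; last by apply/matrixP => -[].
  by split=> [|v]; [apply/matrixP => -[]|rewrite [v]flatmx0 eqxx].
have [MT _] := Mpd.
pose g (a : R) := Num.sqrt (Num.sqrt a).
have [p pg] := interpolation
  [seq complex.Re a | a <- sval (closed_field_poly_normal
     (map_poly (real_complex R) (char_poly M)))] g.
have pE a : eigenvalue M a -> p.[a] = g a.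
  move=> Ma; apply: pg; apply/mapP; exists (real_complex R a) => //.
  move: Ma; rewrite eigenvalue_root_char -(fmorph_root (real_complex R)).
  case: closed_field_poly_normal => /= s {1}->.
  by rewrite (monicP (monic_map _ (char_poly_monic M))) scale1r root_prod_XsubC.
pose Q := horner_mx M p.
have Q4 : Q *m Q *m (Q *m Q) = M.
  apply/eqP; rewrite -subr_eq0; apply/eqP.
  have <- : horner_mx M (p * p * (p * p) - 'X) = Q *m Q *m (Q *m Q) - M.
    by rewrite rmorphB !rmorphM/= horner_mx_X.
  apply: sym_horner_eq0 => // a aM.
  have a0 : 0 <= a by exact/ltW/(posdefmx_eigen Mpd aM).
  rewrite hornerD hornerN hornerX !hornerM (pE _ aM) -!expr2.
  by rewrite /g !sqr_sqrtr ?sqrtr_ge0// subrr.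
have QT : Q^T = Q by exact: horner_mx_sym.
have Qu : Q \in unitmx.
  have := posdefmx_unit Mpd; rewrite -Q4 -mulmxA unitmx_mul.
  by case/andP.
exists (Q *m Q); split=> //; split; first by rewrite trmx_mul QT.
move=> v v0; rewrite /qform.
have : Q *m v != 0.
  by apply: contraNneq v0 => Qv0; rewrite -(mulKmx Qu v) Qv0 mulmx0.
set w := Q *m v => w0.
have -> : v^T *m (Q *m Q) *m v = w^T *m w.
  by rewrite /w trmx_mul QT !mulmxA.
rewrite mxE lt_neqAle sumr_ge0 ?andbT; last first.
  by move=> i _; rewrite mxE -expr2 sqr_ge0.
rewrite eq_sym psumr_eq0; last by move=> i _; rewrite mxE -expr2 sqr_ge0.
apply: contraNN w0 => /allP h; apply/eqP/colP => i; rewrite [RHS]mxE.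
have /implyP := h i (mem_index_enum i).
by rewrite mxE -expr2 sqrf_eq0 => /(_ isT)/eqP.
Qed.

Lemma sqrtmxP n (M : 'M[R]_n) : posdefmx M ->
  posdefmx (sqrtmx M) /\ sqrtmx M *m sqrtmx M = M.
Proof.
move=> /sqrtmx_exists Mex.
exact: (@xgetPex _ 0 [set S | posdefmx S /\ S *m S = M] Mex).
Qed.

Lemma posdefmx_sqr_inj n (S T : 'M[R]_n) :
  posdefmx S -> posdefmx T -> S *m S = T *m T -> S = T.
Proof.
move=> [ST Spos] [TT Tpos] SSTT; pose D := S - T.
have DT : D^T = D by rewrite raddfB/= ST TT.
have DD : D *m S + T *m D = 0.
  by rewrite mulmxBl mulmxBr SSTT addrA subrK subrr.
have tr0 : \tr (D *m (S + T) *m D) = 0.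
  rewrite (mulmxDr D) (mulmxDl (D *m S)) mxtraceD -(mulmxA D T D).
  by rewrite (mxtrace_mulC D (T *m D)) -mxtraceD -mulmxDl DD mul0mx mxtrace0.
have STpos v : v != 0 -> 0 < qform (S + T) v.
  move=> v0; rewrite /qform mulmxDr mulmxDl mxE.
  by rewrite addr_gt0// ?Spos ?Tpos.
have diagE i : (D *m (S + T) *m D) i i = qform (S + T) (col i D).
  rewrite /qform tr_col DT -!row_mul mxE [RHS]mxE [RHS]mxE.
  by apply: eq_bigr => k _; rewrite [col i D k 0]mxE.
have ge0 i : 0 <= (D *m (S + T) *m D) i i.
  rewrite diagE; have [->|/STpos/ltW//] := eqVneq (col i D) 0.
  by rewrite /qform mulmx0 mxE.
apply/eqP; rewrite -subr_eq0 -/D; apply/eqP/matrixP => i j.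
have [/colP/(_ i)|/STpos] := eqVneq (col j D) 0; first by rewrite !mxE.
move: tr0; rewrite /mxtrace => /eqP.
rewrite psumr_eq0// => /allP /(_ j (mem_index_enum j)) /implyP /(_ isT).
by rewrite diagE => /eqP ->; rewrite ltxx.
Qed.

End SquareRoot.

(* Main.v *)
(* The objective is homogeneous of degree 0, so its Euclidean gradient g is
   already tangent to the sphere, and B^{-1/2} g = c B^{-1} r with
   c = 2 x^T B^{-1} x / (x^T B^{-1/2} A B^{-1/2} x)^2 > 0.  With
   theta = eta |g| in ]0, pi/2[ the exponential map gives
   x_{t+1} = cos theta (x_t - (tan theta / |g|) g), whence beta = cos theta and
   eta* = c tan theta / |g|.  If g = 0 then r = 0 and any eta* will do. *)
Require Import Defs.
From mathcomp Require Import all_boot all_order all_algebra.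
From mathcomp Require Import all_classical all_reals all_analysis.
From mathcomp Require Import ring.
Import Order.TTheory GRing.Theory Num.Theory.
Import numFieldNormedType.Exports.
Local Open Scope ring_scope.

(** * Directional derivatives of quadratic forms and of their ratios *)

Lemma is_derive_cvg (R : realType) (V W : normedModType R) (f : V -> W) (x v : V)
    (df : W) :
  ((fun h : R => h^-1 *: (f (h *: v + x) - f x)) @ 0^' --> df)%classic ->
  is_derive x v f df.
Proof. by move=> fdf; split; [apply/cvg_ex; exists df|exact: cvg_lim fdf]. Qed.

Lemma add00 (R : realType) (M N : 'M[R]_1) : (M + N) 0 0 = M 0 0 + N 0 0.
Proof. by rewrite mxE. Qed.

Lemma scale00 (R : realType) (a : R) (M : 'M[R]_1) :
  (a *: M) 0 0 = a * M 0 0.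
Proof. by rewrite mxE. Qed.

(** Symmetry of [M] merges the two cross terms. The factor [h] stays outside so that dividing by it
    leaves a difference quotient affine in [h]. *)
Lemma qformD (R : realType) (n : nat) (M : 'M[R]_n) (x v : 'cV[R]_n) (h : R) :
  M^T = M ->
  qform M (h *: v + x)
    = qform M x + h * (2 * (v^T *m (M *m x)) 0 0 + h * qform M v).
Proof.
move=> MT.
have xv : (x^T *m (M *m v)) 0 0 = (v^T *m (M *m x)) 0 0.
  have -> : x^T *m (M *m v) = (v^T *m (M *m x))^T.
    by rewrite !trmx_mul trmxK MT mulmxA.
  by rewrite mxE.
have qE y : qform M y = (y^T *m (M *m y)) 0 0 by rewrite /qform mulmxA.
rewrite !qE linearD linearZ/= mulmxDr !mulmxDl -!scalemxAr -!scalemxAl.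
rewrite !mulmxDr -!scalemxAr !(add00, scale00) xv; ring.
Qed.

Lemma is_derive_qform (R : realType) (n : nat) (M : 'M[R]_n)
    (x v : 'cV[R]_n) :
  M^T = M -> is_derive x v (qform M) (2 * (v^T *m (M *m x)) 0 0).
Proof.
move=> MT; set d := 2 * _; apply: is_derive_cvg.
(* For [h != 0] the difference quotient is exactly [d + h * qform M v], so its limit is the value of
   that affine map at 0. *)
apply: (@cvg_trans _ ((fun h : R => d + h * qform M v) @ 0^')%classic).
  apply: near_eq_cvg; near=> h.
  have h0 : h != 0 by near: h; exact: nbhs_dnbhs_neq.
  by rewrite qformD// -/d [X in X - _]addrC addrK scalerA mulVf// scale1r.
have cv : ((fun h : R => d + h * qform M v) @ (0 : R)
    --> d + 0 * qform M v)%classic.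
  by apply: cvgD; [exact: cvg_cst|apply: cvgM; [exact: cvg_id|exact: cvg_cst]].
by rewrite mul0r addr0 in cv; exact: cvg_within_filter.
Unshelve. all: by end_near. Qed.

(** Quotient rule, factored so that the bracket is what [B^{-1/2}] later turns into the
    preconditioned residual. *)
Lemma egrad_qform_ratio (R : realType) (n : nat) (M N : 'M[R]_n)
    (x : 'cV[R]_n) :
  M^T = M -> N^T = N -> qform M x != 0 -> qform N x != 0 ->
  egrad (fun y => - (qform M y / qform N y)) x
    = (2 * qform M x / qform N x ^+ 2)
      *: (N *m x - (qform N x / qform M x) *: (M *m x)).
Proof.
move=> MT NT M0 N0; apply/colP => i; rewrite mxE.
set e := delta_mx i 0.
have eE (y : 'cV[R]_n) : (e^T *m y) 0 0 = y i 0.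
  by rewrite trmx_delta -rowE mxE.
have dM := @is_derive_qform _ _ M x e MT.
have dN := @is_derive_qform _ _ N x e NT.
have dV : is_derive x e (fun y => (qform N y)^-1)
    (- qform N x ^- 2 *: (2 * (N *m x) i 0)).
  split; first by apply: derivableV => //; exact: ex_derive.
  by rewrite deriveV ?derive_val ?eE//; exact: ex_derive.
have df := is_deriveN (is_deriveM dM dV).
have entryE a b (p q : 'cV[R]_n) :
  (a *: (p - b *: q)) i 0 = a * (p i 0 - b * q i 0) by rewrite !mxE.
rewrite (@derive_val _ _ _ _ _ _ _ df) eE entryE /GRing.scale/=.
by field; rewrite M0.
Qed.

(** * The Euclidean norm and the exponential map of the sphere *)

Lemma enorm_sqr (R : realType) (n : nat) (v : 'cV[R]_n) :
  enorm v ^+ 2 = (v^T *m v) 0 0.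
Proof.
rewrite sqr_sqrtr// mxE sumr_ge0// => i _.
by rewrite mxE -expr2 sqr_ge0.
Qed.

Lemma enorm_ge0 (R : realType) (n : nat) (v : 'cV[R]_n) : 0 <= enorm v.
Proof. exact: sqrtr_ge0. Qed.

Lemma enorm_eq0 (R : realType) (n : nat) (v : 'cV[R]_n) :
  (enorm v == 0) = (v == 0).
Proof.
rewrite -sqrf_eq0 enorm_sqr mxE psumr_eq0; last first.
  by move=> i _; rewrite mxE -expr2 sqr_ge0.
apply/idP/eqP => [/allP h|->]; last by apply/allP => i _; rewrite !mxE mulr0 eqxx.
apply/colP => i; have := h i (mem_index_enum i).
by rewrite !mxE /= -expr2 sqrf_eq0 => /eqP.
Qed.

Lemma enormZ (R : realType) (n : nat) (a : R) (v : 'cV[R]_n) :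
  enorm (a *: v) = `|a| * enorm v.
Proof.
apply/eqP; rewrite -(@eqrXn2 _ 2) ?mulr_ge0 ?enorm_ge0//.
rewrite enorm_sqr exprMn enorm_sqr real_normK ?num_real//.
by rewrite -scalemxAr linearZ/= -scalemxAl !scale00 mulrA expr2.
Qed.

(** Pythagoras: [x] and [v / |v|] are orthonormal, and cos^2 + sin^2 = 1. *)
Lemma sphere_exp_on_sphere (R : realType) (n : nat) (x v : 'cV[R]_n) :
  on_sphere x -> (x^T *m v) 0 0 = 0 -> on_sphere (sphere_exp x v).
Proof.
rewrite /on_sphere /sphere_exp => x1 xv; case: eqVneq => // v0.
have vn0 : enorm v != 0 by rewrite enorm_eq0.
have vx : (v^T *m x) 0 0 = 0.
  by rewrite -[v^T *m x]trmxK trmx_mul trmxK mxE.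
apply/eqP; rewrite -(@eqrXn2 _ 2) ?enorm_ge0// expr1n enorm_sqr.
rewrite mulmxDr -!scalemxAr linearD !linearZ/= !mulmxDl -!scalemxAl.
rewrite !(add00, scale00) xv vx -!enorm_sqr x1; apply/eqP.
by rewrite -[RHS](cos2Dsin2 (enorm v)); field.
Qed.

(** * The change of variables [u = B^{-1/2} x] and one step of the iteration *)

Section Iteration.
Context {R : realType} {n : nat} {A B : 'M[R]_n}.
Hypotheses (A_posdef : posdefmx A) (B_posdef : posdefmx B).
Let f := objective A B.
Let S := sqrtmx B.
Let C := invmx S *m A *m invmx S.

Let S_unit : S \in unitmx.
Proof. exact: posdefmx_unit (sqrtmxP B_posdef).1. Qed.

Let trS : S^T = S.
Proof. exact: (sqrtmxP B_posdef).1.1. Qed.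

Let trSV : (invmx S)^T = invmx S.
Proof. by rewrite trmx_inv trS. Qed.

Let SS : S *m S = B.
Proof. exact: (sqrtmxP B_posdef).2. Qed.

Let SVSV : invmx S *m invmx S = invmx B.
Proof.
have SVSVB : invmx S *m invmx S *m B = 1%:M.
  by rewrite -[X in _ *m X]SS mulmxA mulmxKV// mulVmx.
by rewrite -[LHS](mulmxK (posdefmx_unit B_posdef)) SVSVB mul1mx.
Qed.

(** Together with [qform_invsqrtmx], this identifies the objective at [x] as minus the reciprocal of
    the Rayleigh quotient of [A] at [u]. *)
Lemma qform_invmx (x : 'cV[R]_n) :
  qform (invmx B) x
    = ((invsqrtmx B *m x)^T *m (invsqrtmx B *m x)) 0 0.
Proof. by rewrite /qform -SVSV trmx_mul trSV !mulmxA. Qed.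

Lemma qform_invsqrtmx (x : 'cV[R]_n) :
  qform (invsqrtmx B *m A *m invsqrtmx B) x = qform A (invsqrtmx B *m x).
Proof. by rewrite /qform trmx_mul trSV !mulmxA. Qed.

(** Since [S * S = B], the map [B^{-1/2}] is an isometry onto the [B]-norm; staying on the sphere
    thus gives the normalization of [u]. *)
Lemma wnorm_invsqrtmx (x : 'cV[R]_n) : wnorm B (invsqrtmx B *m x) = enorm x.
Proof.
rewrite /wnorm /enorm /qform /invsqrtmx -/S -SS trmx_mul trSV !mulmxA.
by rewrite -(mulmxA x^T) mulVmx// mulmx1 -(mulmxA x^T) mulmxV// mulmx1.
Qed.

Lemma invsqrtmx_eq0 (x : 'cV[R]_n) : (invsqrtmx B *m x == 0) = (x == 0).
Proof.
apply/eqP/eqP => [ux|->]; last by rewrite mulmx0.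
by rewrite -[x](mulKVmx S_unit) -/(invsqrtmx B) ux mulmx0.
Qed.

Let c (x : 'cV[R]_n) := 2 * qform (invmx B) x / qform C x ^+ 2.

Let x_neq0 {x : 'cV[R]_n} : on_sphere x -> x != 0.
Proof. by rewrite -enorm_eq0 => ->; rewrite oner_neq0. Qed.

Let N_gt0 {x : 'cV[R]_n} : on_sphere x -> 0 < qform (invmx B) x.
Proof.
move=> /x_neq0 x0; rewrite qform_invmx -enorm_sqr exprn_gt0//.
by rewrite lt_def enorm_ge0 enorm_eq0 invsqrtmx_eq0 x0.
Qed.

Let D_gt0 {x : 'cV[R]_n} : on_sphere x -> 0 < qform C x.
Proof.
by move=> /x_neq0 x0; rewrite qform_invsqrtmx A_posdef.2// invsqrtmx_eq0.
Qed.

Let c_gt0 {x : 'cV[R]_n} : on_sphere x -> 0 < c x.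
Proof.
by move=> xs; rewrite /c divr_gt0 ?exprn_gt0 ?mulr_gt0 ?ltr0n ?N_gt0 ?D_gt0.
Qed.

Lemma egrad_objective {x : 'cV[R]_n} : on_sphere x ->
  egrad f x = c x *: (C *m x - (qform C x / qform (invmx B) x)
                               *: (invmx B *m x)).
Proof.
move=> xs; apply: egrad_qform_ratio.
- by rewrite trmx_inv B_posdef.1.
- by rewrite !trmx_mul trSV A_posdef.1 mulmxA.
- exact/lt0r_neq0/N_gt0.
- exact/lt0r_neq0/D_gt0.
Qed.

(** Euler's identity in degree 0: paired with [x], the two terms of [egrad_objective] cancel, so the
    projection [I - x x^T] fixes the gradient. *)
Lemma rgrad_objective {x : 'cV[R]_n} : on_sphere x ->
  (x^T *m egrad f x) 0 0 = 0 /\ rgrad f x = egrad f x.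
Proof.
move=> xs.
have xg : (x^T *m egrad f x) 0 0 = 0.
  rewrite egrad_objective// -scalemxAr mulmxBr -scalemxAr scale00.
  rewrite (mulmxA _ C) (mulmxA _ (invmx B)) add00 -scaleNr scale00 -/(qform C x).
  rewrite -/(qform (invmx B) x).
  by rewrite mulNr divfK ?subrr ?mulr0//; apply/lt0r_neq0/N_gt0.
split=> //; rewrite /rgrad mulmxBl mul1mx -mulmxA [x^T *m _]mx11_scalar xg.
by rewrite raddf0 mulmx0 subr0.
Qed.

(** With [B^{-1} = S^{-1} S^{-1}], one has [S^{-1} C x = B^{-1} A u] and
    [S^{-1} B^{-1} x = B^{-1} u]. *)
Lemma invsqrtmx_rgrad {x : 'cV[R]_n} (u := invsqrtmx B *m x) :
  on_sphere x ->
  invsqrtmx B *m rgrad f x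
    = c x *: (invmx B *m (A *m u - rayleigh A u *: u)).
Proof.
move=> xs; rewrite (rgrad_objective xs).2 egrad_objective// -scalemxAr.
have <- : rayleigh A u = qform C x / qform (invmx B) x.
  by rewrite /rayleigh qform_invmx qform_invsqrtmx.
by rewrite !mulmxBr -!scalemxAr -SVSV !mulmxA.
Qed.

(** Membership of [y] in the sphere accompanies the update so that the step can be iterated by
    induction. *)
Lemma sphere_exp_step {x : 'cV[R]_n} {eta : R}
    (u := invsqrtmx B *m x) (r := A *m u - rayleigh A u *: u)
    (y := sphere_exp x (- (eta *: rgrad f x))) :
  on_sphere x -> 0 < eta ->
  (rgrad f x != 0 -> eta < pi / (2 * enorm (rgrad f x))) ->
  on_sphere y /\
  exists etastar beta : R, [/\ 0 < etastar, 0 < beta &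
    invsqrtmx B *m y = beta *: (u - etastar *: (invmx B *m r))].
Proof.
move=> xs eta0; rewrite /y; have := invsqrtmx_rgrad xs.
have [xg] := rgrad_objective xs; set g := rgrad f x => gE gr eta_lt.
split.
  apply: sphere_exp_on_sphere => //.
  by rewrite -scaleNr -scalemxAr scale00 gE xg mulr0.
have c0 := lt0r_neq0 (c_gt0 xs).
have {}gr : invmx B *m r = (c x)^-1 *: (invsqrtmx B *m g).
  by rewrite gr scalerA mulVf// scale1r.
have [g0|g0] := eqVneq g 0.
  exists 1, 1; split=> //; rewrite gr g0 mulmx0 !scaler0 subr0 scale1r.
  by rewrite /sphere_exp oppr0 eqxx.
have gn0 : 0 < enorm g by rewrite lt_def enorm_ge0 enorm_eq0 g0.
(* The arc length of the step. The bound on [eta] puts it below pi/2, which makes both [cos th] and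
   [tan th] positive. *)
pose th := eta * enorm g.
have th_gt0 : 0 < th by rewrite mulr_gt0.
have th_lt : th < pi / 2.
  have := eta_lt g0; rewrite ltr_pdivlMr ?mulr_gt0// => h.
  by rewrite ltr_pdivlMr// -mulrA [_ * 2]mulrC.
have cos0 : 0 < cos th.
  by apply: cos_gt0_pihalf; rewrite th_lt andbT (lt_trans _ th_gt0)// oppr_lt0
    divr_gt0// pi_gt0.
have sin0 : 0 < sin th by apply: sin_gt0_pihalf; rewrite th_gt0.
exists (c x * (sin th / cos th / enorm g)), (cos th).
split=> //; first by rewrite mulr_gt0 ?c_gt0// !divr_gt0.
have vE : enorm (- (eta *: g)) = th by rewrite -scaleNr enormZ normrN gtr0_norm.
(* The coefficient of [g] is [- eta * sin th / th = - sin th / |g|], and on the right the factor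
   [c x] of the step size cancels the inverse in [gr]. *)
rewrite /sphere_exp oppr_eq0 scaler_eq0 (negPf g0) gt_eqF//= vE gr.
rewrite mulmxDr -!scalemxAr mulmxN -scalemxAr -scaleNr scalerBr !scalerA -/u.
rewrite -scaleNr; congr (_ + _ *: _); rewrite /th; field.
by rewrite c0 !gt_eqF.
Qed.

End Iteration.

Theorem proposition2 (R : realType) (n : nat) (A B : 'M[R]_n)
    (lam : 'I_n -> R) (x : nat -> 'cV[R]_n) (eta : nat -> R)
    (A_posdef : posdefmx A) (B_posdef : posdefmx B)
    (lam_eigen : eigenvalue_list A lam)
    (lam_gt0 : forall i : 'I_n, 0 < lam i)
    (lam_gap : forall i j : 'I_n, i = 0%N :> nat -> (0 < j)%N -> lam i < lam j)
    (x0_sphere : on_sphere (x 0%N))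
    (x_rec : forall t : nat,
      x t.+1 = sphere_exp (x t) (- (eta t *: rgrad (objective A B) (x t))))
    (eta_gt0 : forall t : nat, 0 < eta t)
    (eta_lt : forall t : nat, rgrad (objective A B) (x t) != 0 ->
      eta t < pi / (2 * enorm (rgrad (objective A B) (x t)))) :
  let u := fun t : nat => invsqrtmx B *m x t in
  let r := fun t : nat => A *m u t - rayleigh A (u t) *: u t in
  exists etastar beta : nat -> R, forall t : nat,
    [/\ 0 < etastar t,
        0 < beta t.+1,
        wnorm B (u t.+1) = 1 &
        u t.+1 = beta t.+1 *: (u t - etastar t *: (invmx B *m r t))].
Proof.
move=> u r.
have step t (xs : on_sphere (x t)) :=
  sphere_exp_step A_posdef B_posdef xs (eta_gt0 t) (eta_lt t).
have xs t : on_sphere (x t).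
  by elim: t => // t /step[+ _]; rewrite -x_rec.
have [etastar etaP] := choice (fun t => (step t (xs t)).2).
have [beta betaP] := choice etaP.
(* The chosen factor is indexed by the step [t], the required one by [t.+1]; composing with [predn]
   shifts the index. *)
exists etastar, (beta \o predn) => t; have [e0 b0 uE] := betaP t.
split=> //=; rewrite /u; first by rewrite wnorm_invsqrtmx ?xs.
by rewrite x_rec uE.
Qed.
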